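(* Let $\Theta_1,\dots,\Theta_n$ be hyperplanes in $\mathbb R^d$ with $\bigcap_i\Theta_i=\{0\}$, $\Theta_e=\ker\ell_e$ for linear forms $\ell_e$, and let $\mathcal A=\{H_1,\dots,H_n\}$ be the corresponding complexified arrangement in $\mathbb C^d$. Then $\mathcal L=\{\alpha_{\vec z}:\vec z\in\mathbb C^d\}$ is an oriented interval greedoid over $(E_{\mathcal A},\mathcal F_{\mathcal A})$, i.e. $(E_{\mathcal A},\mathcal F_{\mathcal A},\mathcal L)$ is an oriented interval greedoid.
   Context: Extend each $\ell_e$ $\mathbb C$-linearly to $\mathbb C^d$; $H_e=\{\vec z:\ell_e(\vec z)=0\}$ and $H_e^{\Re}=\{\vec z:\mathrm{Im}(\ell_e(\vec z))=0\}$. Let $E_{\mathcal A}=\{H_1,\dots,H_n,H_1^\Re,\dots,H_n^\Re\}$ and $\mathcal L_{\mathcal A}$ the lattice of all intersections of subspaces from $E_{\mathcal A}$ ordered by inclusion; $\mathcal F_{\mathcal A}=\{\{h_1,\dots,h_k\}\subseteq E_{\mathcal A}:\mathbb C^d\gtrdot h_1\gtrdot h_1\cap h_2\gtrdot\cdots\gtrdot h_1\cap\cdots\cap h_k\}$ (covers in $\mathcal L_{\mathcal A}$); $(E_{\mathcal A},\mathcal F_{\mathcal A})$ is an interval greedoid. For $z=x+iy\in\mathbb C$: $\sigma_\Re(z)=1$ if $y\neq0$, $+$ if $y=0,x>0$, $-$ if $y=0,x<0$, $0$ if $z=0$; $\sigma_\Im(z)=+,-,0$ according as $y>0,y<0,y=0$.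 For $\vec z\in\mathbb C^d$, $\alpha_{\vec z}(H_i^\Re)=\sigma_\Im(\ell_i(\vec z))$ and $\alpha_{\vec z}(H_i)=\sigma_\Re(\ell_i(\vec z))$. Interval greedoid: finite $E$, nonempty family $\mathcal F$ with (IG1) each nonempty $X\in\mathcal F$ has $x$ with $X\setminus\{x\}\in\mathcal F$; (IG2) if $|X|>|Y|$ there is $x\in X\setminus Y$ with $Y\cup\{x\}\in\mathcal F$; (IG3) if $X\subseteq Y\subseteq Z$ in $\mathcal F$, $e\notin Z$, $X\cup\{e\},Z\cup\{e\}\in\mathcal F$, then $Y\cup\{e\}\in\mathcal F$. $\Gamma(X)=\{x\in E\setminus X:X\cup\{x\}\in\mathcal F\}$; $X\sim Y$ iff $\Gamma(X)=\Gamma(Y)$; classes $[X]$ are flats; $\Phi$ the set of flats ordered by $[X]\le[Y]$ iff there is $Z\subseteq E\setminus Y$ with $Y\cup Z\in\mathcal F$ and $Y\cup Z\sim X$ (a lattice). For a flat $A=[X]$: $\Gamma(A)=\Gamma(X)$, $\xi(A)=\bigcup_{X'\sim X}X'$; $\mu(S)=[X]$ for $X$ inclusion-maximal feasible in $S$; join $A\vee B=\mu(\xi(A)\cap\xi(B))$. A covector is $\alpha:E\to\{0,+,-,1\}$ such that for some flat $A=\mathrm{supp}(\alpha)$, $\alpha\in\{+,-\}$ on $\Gamma(A)$, $0$ on $\xi(A)$, $1$ elsewhere. Symbols ordered $0<+<1$, $0<-<1$. Product: with $C=\mathrm{supp}\,\alpha\vee\mathrm{supp}\,\beta$, $(\alpha\circ\beta)(e)=\beta(e)$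 if $e\in\Gamma(C)\cup\xi(C)$ and $\beta(e)>\alpha(e)$; $\alpha(e)$ if $e\in\Gamma(C)\cup\xi(C)$ otherwise; $1$ otherwise. $-\alpha$ swaps $+,-$; $S(\alpha,\beta)=\{e:\alpha(e)=-\beta(e)\in\{+,-\}\}$. Oriented interval greedoid: $(E,\mathcal F,\mathcal L)$, $\mathcal L$ a set of covectors with (OG1) $\mathrm{supp}:\mathcal L\to\Phi$ surjective; (OG2) $-\mathcal L=\mathcal L$; (OG3) closed under $\circ$; (OG4) if $\alpha,\beta\in\mathcal L$, $x\in S(\alpha,\beta)$, $(\alpha\circ\beta)(x)\ne1$, some $\gamma\in\mathcal L$ has $\gamma(x)=0$ and $\gamma(y)=(\alpha\circ\beta)(y)=(\beta\circ\alpha)(y)$ for all $y\notin S(\alpha,\beta)$ with $(\alpha\circ\beta)(y)\neq1$. *)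

(* Defs.v *)
From HB Require Import structures.
From mathcomp Require Import all_boot all_order all_algebra.
From mathcomp Require Import boolp classical_sets reals.
From mathcomp Require Import complex.

Set Implicit Arguments.
Unset Strict Implicit.
Unset Printing Implicit Defensive.

Import Order.TTheory GRing.Theory Num.Theory.

Local Open Scope ring_scope.

Section Greedoid.
Variables (E : finType) (F : {set {set E}}).
Implicit Types (X Y Z S : {set E}) (A B : {set {set E}}).

Definition IG1 : Prop :=
  forall X, X \in F -> X != finset.set0 -> exists2 x, x \in X & X :\ x \in F.

Definition IG2 : Prop :=
  forall X Y, X \in F -> Y \in F -> (#|Y| < #|X|)%N ->
  exists2 x, x \in X :\: Y & x |: Y \in F.

Definition IG3 : Prop :=
  forall X Y Z e, X \in F -> Y \in F -> Z \in F ->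
  X \subset Y -> Y \subset Z -> e \notin Z ->
  e |: X \in F -> e |: Z \in F -> e |: Y \in F.

Definition interval_greedoid : Prop :=
  [/\ F != finset.set0, IG1, IG2 & IG3].

Definition Gam X : {set E} := [set x in ~: X | x |: X \in F].

(* The flat [X] is the class of X for X ~ Y :<-> Gam X = Gam Y on F. *)
Definition flat_of X : {set {set E}} := [set Y in F | Gam Y == Gam X].

Definition flats : {set {set {set E}}} := [set flat_of X | X in F].

(* Gam is constant on a flat, so this union is Gam X for every X in A. *)
Definition flat_Gam A : {set E} := (\bigcup_(X in A) Gam X)%SET.

Definition flat_xi A : {set E} := (\bigcup_(X in A) X)%SET.

(* In an interval greedoid all the inclusion-maximal feasible subsets of S    *)
(* are equivalent, so the flat does not depend on the one picked; one exists  *)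
(* because the empty set is feasible.                                         *)
Definition flat_mu S : {set {set E}} :=
  flat_of (odflt finset.set0
    [pick X | maxset [pred Y : {set E} | (Y \in F) && (Y \subset S)] X]).

Definition flat_join A B : {set {set E}} := flat_mu (flat_xi A :&: flat_xi B).

End Greedoid.

Inductive gsign : Set := Zero | Plus | Minus | One.

Definition gsign_opp (a : gsign) : gsign :=
  match a with Plus => Minus | Minus => Plus | _ => a end.

(* Zero < Plus < One and Zero < Minus < One; Plus, Minus are incomparable.    *)
Definition gsign_lt (a b : gsign) : bool :=
  match a, b with
  | Zero, (Plus | Minus | One) | (Plus | Minus), One => true
  | _, _ => false
  end.

Section OrientedGreedoid.
Variables (E : finType) (F : {set {set E}}).
Implicit Types (al be ga : E -> gsign) (A : {set {set E}}).

Definition is_supp al A : Prop :=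
  A \in flats F /\
  forall e, [/\ e \in flat_Gam F A -> al e = Plus \/ al e = Minus,
                e \in flat_xi A -> al e = Zero
              & e \notin flat_Gam F A :|: flat_xi A -> al e = One].

Definition covector al : Prop := exists A, is_supp al A.

(* A covector has exactly one support; the default value is irrelevant.       *)
Definition supp al : {set {set E}} :=
  xget finset.set0 (is_supp al : classical_sets.set {set {set E}}).

Definition cov_opp al : E -> gsign := fun e => gsign_opp (al e).

Definition cov_comp al be : E -> gsign := fun e =>
  let C := flat_join F (supp al) (supp be) in
  if e \in flat_Gam F C :|: flat_xi C then
    if gsign_lt (al e) (be e) then be e else al e
  else One.

Definition sep al be (e : E) : Prop :=
  al e = gsign_opp (be e) /\ (al e = Plus \/ al e = Minus).

Variable L : classical_sets.set (E -> gsign).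

Definition OG1 : Prop :=
  forall A, A \in flats F -> exists2 al, L al & supp al = A.

Definition OG2 : Prop := (cov_opp @` L)%classic = L.

Definition OG3 : Prop := forall al be, L al -> L be -> L (cov_comp al be).

Definition OG4 : Prop :=
  forall al be x, L al -> L be -> sep al be x -> cov_comp al be x <> One ->
  exists ga, [/\ L ga, ga x = Zero &
    forall y, ~ sep al be y -> cov_comp al be y <> One ->
      ga y = cov_comp al be y /\ cov_comp al be y = cov_comp be al y].

Definition oriented_interval_greedoid : Prop :=
  [/\ interval_greedoid F, forall al, L al -> covector al
    & [/\ OG1, OG2, OG3 & OG4]].

End OrientedGreedoid.

Section Complexified.
Variables (R : realType) (d n : nat) (l : 'I_n -> 'Hom('rV[R]_d, R^o)).

Local Notation V := 'rV[R[i]]_d.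

(* The C-linear extension of a real linear form: f(x + iy) = f(x) + i f(y).   *)
Definition cext (f : 'Hom('rV[R]_d, R^o)) (z : V) : R[i] :=
  Complex (f (map_mx (@complex.Re R) z)) (f (map_mx (@complex.Im R) z)).

(* Labels for E_A: inl i stands for H_i and inr i for H_i^Re.                 *)
Definition gset : finType := ('I_n + 'I_n)%type.

Definition subsp (e : gset) : classical_sets.set V :=
  match e with
  | inl i => [set z : V | cext (l i) z = 0]%classic
  | inr i => [set z : V | complex.Im (cext (l i) z) = 0]%classic
  end.

(* The empty intersection is the whole space.                                 *)
Definition int_lattice : classical_sets.set (classical_sets.set V) :=
  [set W | exists S : {set gset},
     W = \bigcap_(e in [set` S]) subsp e]%classic.

Definition lattice_cover (W W' : classical_sets.set V) : Prop :=
  [/\ int_lattice W, int_lattice W', (W' `<` W)%classic &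
      forall U, int_lattice U ->
        (W' `<=` U)%classic -> (U `<=` W)%classic -> U = W' \/ U = W].

(* For s = h_1, ..., h_k, each of W, W `&` h_1, ..., W `&` h_1 `&` ... `&` h_k *)
(* covers the next one.                                                       *)
Fixpoint cover_chain (W : classical_sets.set V) (s : seq gset) : Prop :=
  if s is h :: s' then
    lattice_cover W (W `&` subsp h)%classic /\
    cover_chain (W `&` subsp h)%classic s'
  else True.

Definition feasible : {set {set gset}} :=
  [set X : {set gset} |
    `[< exists s : seq gset, X = [set:: s] /\ cover_chain setT s >]].

Definition sigma_Re (z : R[i]) : gsign :=
  if complex.Im z != 0 then One
  else if 0 < complex.Re z then Plus
  else if complex.Re z < 0 then Minus else Zero.

Definition sigma_Im (z : R[i]) : gsign :=
  if 0 < complex.Im z then Plus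
  else if complex.Im z < 0 then Minus else Zero.

Definition alpha (z : V) (e : gset) : gsign :=
  match e with
  | inl i => sigma_Re (cext (l i) z)
  | inr i => sigma_Im (cext (l i) z)
  end.

Definition covectors : classical_sets.set (gset -> gsign) :=
  [set alpha z | z in [set: V]]%classic.

End Complexified.

(* Main.v *)
(** Over z = x + iy, the members of the lattice are the sets Q + iP, where
    P \subset Q are intersections of real hyperplanes. Hence adjoining H_i^Re is
    a cover exactly when it cuts P, and adjoining H_i is a cover exactly when
    P lies in Theta_i and Q does not. The feasible sets are therefore pairs of
    independent sets A (labels of the H_i) and B (labels of the H_i^Re) of the
    matroid of the l_i, with A in the span of B, and flats are nested pairs of
    matroid flats. The support of alpha_z is the flat whose xi is the set of
    members of E_A containing z. For small t > 0, alpha_z o alpha_w is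
    alpha_(z + t w), and the elimination axiom is met by alpha_(s z + t w) with
    s, t > 0 chosen to make the separating coordinate vanish. *)
Require Import Defs.
From mathcomp Require Import boolp classical_sets.
From mathcomp Require Import all_boot all_order all_algebra.
From mathcomp Require Import reals complex ring lra.

Set Implicit Arguments.
Unset Strict Implicit.
Unset Printing Implicit Defensive.

Import Order.TTheory GRing.Theory Num.Theory.

Local Open Scope ring_scope.

(** * Cutting a subspace by the kernel of a linear form *)

Lemma dim_capv_lker_geq (K : fieldType) (V : vectType K) (f : 'Hom(V, K^o))
    (U : {vspace V}) : (\dim U <= (\dim (U :&: lker f)).+1)%N.
Proof.
rewrite -(limg_ker_dim f U) -addn1 leq_add2l.
by apply: leq_trans (dimvS (subvf _)) _; rewrite dimvf.
Qed.

(** The image of [U] under [f] is zero or the whole line, so by rank-nullity the dimension drops by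
    one exactly when [f] does not vanish on [U]. *)
Lemma dim_capv_lker (K : fieldType) (V : vectType K) (f : 'Hom(V, K^o))
    (U : {vspace V}) :
  ((\dim (U :&: lker f)).+1 == \dim U) = ~~ (U <= lker f)%VS.
Proof.
case: (boolP (U <= lker f)%VS) => [/capv_idPl-> | nUf]; first by rewrite gtn_eqF.
apply/eqP/anti_leq; rewrite dim_capv_lker_geq andbT.
rewrite -(limg_ker_dim f U) -addn1 leq_add2l lt0n dimv_eq0.
by rewrite -lkerE.
Qed.

(** * Common kernels and independent sets of the forms *)

Section Feasible.
Variables (R : realType) (d n : nat) (l : 'I_n -> 'Hom('rV[R]_d, R^o)).
Implicit Types (A B : {set 'I_n}) (X Y Z S : {set gset n}) (U : {vspace 'rV[R]_d}).

(** Matroid flats are handled through their annihilators: $\ell_i$ lies in the span of the forms of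
    [A] iff it vanishes on [ker_of A], and inclusions are reversed. *)
Definition ker_of A : {vspace 'rV[R]_d} := (\bigcap_(i in A) lker (l i))%VS.

Lemma ker_ofP U A :
  reflect (forall i, i \in A -> (U <= lker (l i))%VS) (U <= ker_of A)%VS.
Proof. exact: subv_bigcapP. Qed.

Lemma mem_ker_ofP x A :
  reflect (forall i, i \in A -> l i x = 0) (x \in ker_of A).
Proof.
by rewrite memvE; apply: (iffP (ker_ofP _ _)) => H i /H;
  rewrite -memvE memv_ker => /eqP.
Qed.

Lemma ker_of_sub A i : i \in A -> (ker_of A <= lker (l i))%VS.
Proof. by move: i; apply/ker_ofP. Qed.

Lemma ker_ofS A B : A \subset B -> (ker_of B <= ker_of A)%VS.
Proof. by move=> /subsetP sAB; apply/ker_ofP => i /sAB /ker_of_sub. Qed.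

Lemma ker_of0 : ker_of finset.set0 = fullv.
Proof. by rewrite /ker_of big_set0. Qed.

Lemma ker_ofU1 i A : ker_of (i |: A) = (ker_of A :&: lker (l i))%VS.
Proof.
apply/eqP; rewrite eqEsubv subv_cap ker_ofS ?subsetUr //=.
rewrite ker_of_sub ?setU11 //=; apply/ker_ofP => j /setU1P[->|jA].
  exact: capvSr.
exact: subv_trans (capvSl _ _) (ker_of_sub jA).
Qed.

Lemma ker_ofD1 i A : i \in A -> ker_of A = (ker_of (A :\ i) :&: lker (l i))%VS.
Proof. by move=> iA; rewrite -ker_ofU1 setD1K. Qed.

Lemma dim_ker_of_geq A : (\dim {:'rV[R]_d} <= \dim (ker_of A) + #|A|)%N.
Proof.
move: {2}#|A| (erefl #|A|) => k; elim: k A => [|k IH] A.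
  by move/eqP; rewrite cards_eq0 => /eqP->; rewrite ker_of0 leq_addr.
move=> cA; have [i iA] : exists i, i \in A by apply/card_gt0P; rewrite cA.
move: cA; rewrite (ker_ofD1 iA) (cardsD1 i A) iA add1n => -[/IH /leq_trans->] //.
by rewrite addnS -addSn leq_add2r dim_capv_lker_geq.
Qed.

(** Linear independence of the forms of [A], read off from the codimension of their common kernel;
    one inequality always holds. *)
Definition indep A := (\dim (ker_of A) + #|A| == \dim {:'rV[R]_d})%N.

Lemma indep0 : indep finset.set0.
Proof. by rewrite /indep ker_of0 cards0 addn0. Qed.

Lemma indepU1 A i : indep A ->
  (i \notin A) && indep (i |: A) = ~~ (ker_of A <= lker (l i))%VS.
Proof.
move=> /eqP iA; case: (boolP (i \in A)) => [/ker_of_sub->//|niA /=].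
rewrite /indep cardsU1 niA (add1n #|_|) addnS -addSn -iA eqn_add2r ker_ofU1.
exact: dim_capv_lker.
Qed.

(** Dropping [i] lowers the cardinality by one and raises the dimension by at most one, so the sum
    cannot exceed its minimum. *)
Lemma indepD1 A i : i \in A -> indep A -> indep (A :\ i).
Proof.
move=> iA /eqP dA; apply/eqP/anti_leq; rewrite dim_ker_of_geq andbT.
apply: leq_trans (eq_leq dA); rewrite (ker_ofD1 iA).
rewrite (cardsD1 i A) iA (add1n #|_ :\ _|) addnS -addSn leq_add2r.
exact: dim_capv_lker_geq.
Qed.

(** * Nested pairs of independent sets and the greedoid axioms *)

Definition Hlab X : {set 'I_n} := [set i | inl i \in X].
Definition Relab X : {set 'I_n} := [set i | inr i \in X].
Definition kerH X := ker_of (Hlab X).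
Definition kerRe X := ker_of (Relab X).

(** The inclusion of kernels says that the forms labelled in [Hlab X] lie in the span of those
    labelled in [Relab X]. This turns out to be feasibility. *)
Definition nested_indep X :=
  [&& indep (Relab X), indep (Hlab X) & (kerRe X <= kerH X)%VS].

(* For feasible X: the step from X to e |: X is a cover. *)
Definition addable X (e : gset n) : bool :=
  match e with
  | inl i => (kerRe X <= lker (l i))%VS && ~~ (kerH X <= lker (l i))%VS
  | inr i => ~~ (kerRe X <= lker (l i))%VS
  end.

Lemma HlabU1 X i : Hlab (inl i |: X) = i |: Hlab X.
Proof. by apply/setP => j; rewrite !inE. Qed.
Lemma HlabU1r X i : Hlab (inr i |: X) = Hlab X.
Proof. by apply/setP => j; rewrite !inE. Qed.
Lemma RelabU1 X i : Relab (inr i |: X) = i |: Relab X.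
Proof. by apply/setP => j; rewrite !inE. Qed.
Lemma RelabU1l X i : Relab (inl i |: X) = Relab X.
Proof. by apply/setP => j; rewrite !inE. Qed.
Lemma HlabD1 X i : Hlab (X :\ inl i) = Hlab X :\ i.
Proof. by apply/setP => j; rewrite !inE. Qed.
Lemma HlabD1r X i : Hlab (X :\ inr i) = Hlab X.
Proof. by apply/setP => j; rewrite !inE. Qed.
Lemma RelabD1 X i : Relab (X :\ inr i) = Relab X :\ i.
Proof. by apply/setP => j; rewrite !inE. Qed.
Lemma RelabD1l X i : Relab (X :\ inl i) = Relab X.
Proof. by apply/setP => j; rewrite !inE. Qed.

Lemma HlabS X Y : X \subset Y -> Hlab X \subset Hlab Y.
Proof. by move=> /subsetP sXY; apply/subsetP => i; rewrite !inE => /sXY. Qed.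
Lemma RelabS X Y : X \subset Y -> Relab X \subset Relab Y.
Proof. by move=> /subsetP sXY; apply/subsetP => i; rewrite !inE => /sXY. Qed.

Lemma card_lab X : #|X| = (#|Relab X| + #|Hlab X|)%N.
Proof.
rewrite addnC -(card_imset (Hlab X) (@inl_inj 'I_n 'I_n)).
rewrite -(card_imset (Relab X) (@inr_inj 'I_n 'I_n)) -cardsUI.
rewrite [X in (_ + #|pred_of_set X|)%N](_ : _ = finset.set0); last first.
  apply/setP => e; rewrite !inE; apply/andP => -[/imsetP[i _ ->] /imsetP[j _]] //.
rewrite cards0 addn0; apply: eq_card => -[i|i]; rewrite !inE.
  rewrite (mem_imset _ _ (@inl_inj _ _)) inE.
  by case: (_ \in X) => //; apply/esym/imsetP => -[].
rewrite (mem_imset _ _ (@inr_inj _ _)) inE.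
by case: (_ \in X); rewrite ?orbT ?orbF //; apply/esym/imsetP => -[].
Qed.

Lemma nested_indep0 : nested_indep finset.set0.
Proof.
have H0 : Hlab finset.set0 = finset.set0 by apply/setP => i; rewrite !inE.
have R0 : Relab finset.set0 = finset.set0 by apply/setP => i; rewrite !inE.
by rewrite /nested_indep /kerRe /kerH H0 R0 !indep0 subvv.
Qed.

(** A new $H_i$ shrinks only [kerH], so nestedness asks that $\ell_i$ vanish on [kerRe X]; a new
    $H_i^\Re$ shrinks only [kerRe], which preserves nestedness. *)
Lemma nested_indepU1 X e : nested_indep X -> (e \notin X) && nested_indep (e |: X) = addable X e.
Proof.
move=> /and3P[iR iH sRH]; case: e => i /=.
  rewrite /nested_indep /kerRe /kerH HlabU1 RelabU1l iR ker_ofU1 subv_cap sRH /=.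
  rewrite andbA andbC -(indepU1 _ iH) inE; congr (_ && _).
rewrite /nested_indep /kerRe /kerH HlabU1r RelabU1 iH ker_ofU1 /= andbA.
rewrite -/(kerRe X) -/(kerH X) (subv_trans (capvSl _ _) sRH) andbT.
by rewrite -(indepU1 _ iR) inE.
Qed.

Lemma nested_indep_addable X e : nested_indep X -> addable X e -> nested_indep (e |: X).
Proof. by move=> gX; rewrite -nested_indepU1 // => /andP[]. Qed.

Lemma nested_indep_IG1 X : nested_indep X -> X != finset.set0 ->
  exists e, [/\ e \in X, nested_indep (X :\ e) & addable (X :\ e) e].
Proof.
move=> gX X0.
suff [e eX gXe] : exists2 e, e \in X & nested_indep (X :\ e).
  by exists e; split; rewrite // -nested_indepU1 // setD1K // gX setD11.
move: gX => /and3P[iR iH sRH].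
(* Any $H_i$ can be removed first, since this only enlarges [kerH]. Without such labels [kerH] is
   the whole space and any $H_i^\Re$ can go. *)
case: (set_0Vmem (Hlab X)) => [H0 | [i iX]]; last first.
  exists (inl i); first by rewrite inE in iX.
  rewrite /nested_indep /kerRe /kerH HlabD1 RelabD1l iR indepD1 //=.
  exact: subv_trans sRH (ker_ofS (subD1set _ _)).
case/set0Pn: X0 => -[] i iX; first by move/setP/(_ i): H0; rewrite !inE iX.
exists (inr i) => //.
rewrite /nested_indep /kerRe /kerH HlabD1r RelabD1 H0 indep0 indepD1 ?inE //=.
by rewrite ker_of0 subvf.
Qed.

(** If all forms of [A] vanished on [ker_of B], then [ker_of B] would lie in [ker_of A], and
    comparing codimensions would give $|A|\le|B|$. *)
Lemma indep_exchange A B : indep A -> indep B -> (#|B| < #|A|)%N ->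
  exists2 i, i \in A & ~~ (ker_of B <= lker (l i))%VS.
Proof.
move=> /eqP iA /eqP iB ltBA; apply/exists_inP; rewrite -negb_forall_in.
apply: contraL ltBA => /forall_inP sBA; rewrite -leqNgt.
have /dimvS : (ker_of B <= ker_of A)%VS by apply/ker_ofP.
by rewrite -(leq_add2r #|A|) iA -iB leq_add2l.
Qed.

Lemma nested_indep_IG2 X Y : nested_indep X -> nested_indep Y -> (#|Y| < #|X|)%N ->
  exists2 e, e \in X & addable Y e.
Proof.
move=> /and3P[iRX iHX sX] /and3P[iRY iHY sY] ltYX.
case: (boolP [exists (i | i \in Relab X), ~~ (kerRe Y <= lker (l i))%VS]).
  by case/exists_inP => i; rewrite inE => iX ?; exists (inr i).
(* No $H_i^\Re$ of [X] can be added, so [Relab X] is no larger than [Relab Y] and [Hlab X] must be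
   larger than [Hlab Y]. An $H_i$ obtained by exchange is admissible because [kerRe Y] lies in
   [kerRe X], hence in [kerH X]. *)
rewrite -negb_forall_in negbK => /forall_inP sYX.
have sRYX : (kerRe Y <= kerRe X)%VS by apply/ker_ofP.
have leRX : (#|Relab X| <= #|Relab Y|)%N.
  rewrite leqNgt; apply/negP => /(indep_exchange iRX iRY)[i /sYX].
  by rewrite /kerRe => ->.
have [i iX nYi] : exists2 i, i \in Hlab X & ~~ (kerH Y <= lker (l i))%VS.
  apply: indep_exchange => //; rewrite ltnNge; apply: contraL ltYX => leHX.
  by rewrite -leqNgt !card_lab leq_add.
exists (inl i); first by rewrite inE in iX.
rewrite /= nYi andbT; apply: subv_trans sRYX _; apply: subv_trans sX _.
exact: ker_of_sub.
Qed.

Lemma kerHS X Y : X \subset Y -> (kerH Y <= kerH X)%VS.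
Proof. by move/HlabS/ker_ofS. Qed.
Lemma kerReS X Y : X \subset Y -> (kerRe Y <= kerRe X)%VS.
Proof. by move/RelabS/ker_ofS. Qed.

(** Kernels shrink as sets grow: vanishing on a kernel passes up from [X], non-vanishing passes down
    from [Z]. *)
Lemma addable_mid X Y Z e : X \subset Y -> Y \subset Z ->
  addable X e -> addable Z e -> addable Y e.
Proof.
move=> sXY sYZ; case: e => i /=.
  case/andP=> /(subv_trans (kerReS sXY)) -> _ /andP[_].
  by apply: contra; apply: subv_trans (kerHS sYZ).
by move=> _; apply: contra; apply: subv_trans (kerReS sYZ).
Qed.


Lemma kerRe_nested_indep X : nested_indep X -> ker_of (Hlab X :|: Relab X) = kerRe X.
Proof.
case/and3P=> _ _ /ker_ofP sRH; apply/eqP; rewrite eqEsubv ker_ofS ?subsetUr //=.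
by apply/ker_ofP => i /setUP[/sRH // | /ker_of_sub].
Qed.

(** * Lattice members as real and imaginary components; covers *)

Definition cvec (x y : 'rV[R]_d) : 'rV[R[i]]_d := \row_j Complex (x 0 j) (y 0 j).
Definition repart (z : 'rV[R[i]]_d) : 'rV[R]_d := map_mx (@complex.Re R) z.
Definition impart (z : 'rV[R[i]]_d) : 'rV[R]_d := map_mx (@complex.Im R) z.

Lemma cvec_repart x y : repart (cvec x y) = x.
Proof. by apply/rowP => j; rewrite !mxE. Qed.
Lemma cvec_impart x y : impart (cvec x y) = y.
Proof. by apply/rowP => j; rewrite !mxE. Qed.

Definition subspI S : classical_sets.set 'rV[R[i]]_d :=
  (\bigcap_(e in [set` S]) subsp l e)%classic.

(** $H_i$ constrains both parts of $z$, $H_i^\Re$ only the imaginary part. *)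
Lemma subspI_mem S z : subspI S z <->
  repart z \in kerH S /\ impart z \in ker_of (Hlab S :|: Relab S).
Proof.
split=> [Sz | [/mem_ker_ofP Hz /mem_ker_ofP Iz] e eS].
  split; apply/mem_ker_ofP => i; rewrite !inE; first by move/Sz=> -[].
  by case/orP=> /Sz // -[].
case: e eS => i /= iS; last by apply: Iz; rewrite !inE iS orbT.
by rewrite /cext Hz ?Iz ?inE ?iS.
Qed.

(** Testing on purely real and purely imaginary vectors separates the two components. *)
Lemma subspI_sub S T : (subspI S `<=` subspI T)%classic <->
  (kerH S <= kerH T)%VS /\
  (ker_of (Hlab S :|: Relab S) <= ker_of (Hlab T :|: Relab T))%VS.
Proof.
split=> [sST | [/subvP sH /subvP sI] z /subspI_mem[/sH Hz /sI Iz]]; last exact/subspI_mem.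
split; apply/subvP => x xS.
  have /sST/subspI_mem[] : subspI S (cvec x 0).
    by apply/subspI_mem; rewrite cvec_repart cvec_impart mem0v.
  by rewrite cvec_repart.
have /sST/subspI_mem[] : subspI S (cvec 0 x).
  by apply/subspI_mem; rewrite cvec_repart cvec_impart mem0v.
by rewrite cvec_impart.
Qed.

Lemma subspIU1 S e : (subspI S `&` subsp l e)%classic = subspI (e |: S).
Proof.
apply/predeqP => z; split=> [[Sz ez] f /setU1P[->|/Sz] | Sz] //.
by split=> [f fS|]; apply: Sz; rewrite /= !inE ?fS ?orbT ?eqxx.
Qed.

Lemma subspI_lattice S : int_lattice l (subspI S).
Proof. by exists S. Qed.

Lemma capv_lker_between (f : 'Hom('rV[R]_d, R^o)) U W :
  (U :&: lker f <= W)%VS -> (W <= U)%VS -> W = (U :&: lker f)%VS \/ W = U.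
Proof.
move=> sW sWU; case: (boolP (U <= W)%VS) => [sUW | nUW].
  by right; apply/eqP; rewrite eqEsubv sWU.
left; apply/eqP; rewrite eq_sym eqEdim sW -ltnS.
apply: leq_trans (dim_capv_lker_geq f U).
rewrite ltn_neqAle dimvS // andbT; apply: contra nUW => /eqP dWU.
have : W == U by rewrite eqEdim sWU dWU /=.
by move/eqP->; rewrite subvv.
Qed.

Lemma lattice_cover_addable S e : nested_indep S ->
  lattice_cover l (subspI S) (subspI S `&` subsp l e)%classic <-> addable S e.
Proof.
move=> gS; have kS := kerRe_nested_indep gS; rewrite subspIU1.
split=> [[_ _ [sTS nST] cov] | aSe].
  have {}nST : ~ (subspI S `<=` subspI (e |: S))%classic by [].
  case: e sTS nST cov => i /= sTS nST cov.
    case: (boolP (kerRe S <= _)%VS) => [sRi | nRi] /=.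
      apply/negP => sHi; apply: nST; apply/subspI_sub.
      rewrite /kerH HlabU1 RelabU1l -setUA !ker_ofU1 kS !subv_cap sHi sRi.
      by rewrite !subvv.
    have sH : ~~ (kerH S <= lker (l i))%VS.
      by apply: contra nRi; apply: subv_trans; case/and3P: gS.
    (* When $\ell_i$ is nonzero on [kerRe S], cutting by $H_i^\Re$ gives a member strictly between,
       so cutting by $H_i$ is not a cover. *)
    case: (cov (subspI (inr i |: S)) (subspI_lattice _)).
    - apply/subspI_sub; rewrite /kerH HlabU1 RelabU1l HlabU1r RelabU1 setUCA -setUA.
      by rewrite subvv ker_ofU1 capvSl.
    - by rewrite -subspIU1 => z [].
    - move=> E; have /subspI_sub[] : (subspI (inr i |: S) `<=` subspI (inl i |: S))%classic.
        by rewrite E.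
      rewrite /kerH HlabU1 HlabU1r ker_ofU1 subv_cap => /andP[_ sHi].
      by rewrite /kerH sHi in sH.
    move=> E; have /subspI_sub[_] : (subspI S `<=` subspI (inr i |: S))%classic.
      by rewrite E.
    rewrite HlabU1r RelabU1 setUCA ker_ofU1 kS subv_cap => /andP[_ sRi].
    by rewrite sRi in nRi.
  apply/negP => sRi; apply: nST; apply/subspI_sub.
  by rewrite /kerH HlabU1r RelabU1 setUCA ker_ofU1 kS subv_cap sRi !subvv.
have gT := nested_indep_addable gS aSe; have kT := kerRe_nested_indep gT.
split; try exact: subspI_lattice.
- split; first by rewrite -subspIU1 => z [].
  move/subspI_sub; rewrite kS kT; case: e aSe {gT kT} => i /=.
    case/andP=> _ /negP nHi [sH _]; apply: nHi.
    by move: sH; rewrite /kerH HlabU1 ker_ofU1 subv_cap => /andP[].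
  move=> /negP nRi [_ sR]; apply: nRi.
  by move: sR; rewrite /kerRe RelabU1 ker_ofU1 subv_cap => /andP[].
move=> _ [Q ->]; rewrite -/(subspI Q) => /subspI_sub[sHTQ sITQ].
move=> /subspI_sub[sHQS sIQS].
(* A lattice member is determined by its two components. The step cuts just one of them, by a
   hyperplane; the other is squeezed to equality, so nothing fits strictly between. *)
have eqW Q1 Q2 : kerH Q1 = kerH Q2 ->
    ker_of (Hlab Q1 :|: Relab Q1) = ker_of (Hlab Q2 :|: Relab Q2) ->
    subspI Q1 = subspI Q2.
  by move=> eH eI; apply/predeqP => z; rewrite !subspI_mem eH eI.
move: sITQ sIQS; rewrite kS kT.
case: e aSe sHTQ {gT} kT => i /= aSe; rewrite /kerH /kerRe.
  rewrite HlabU1 RelabU1l ker_ofU1 => sHTQ kT sITQ sIQS.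
  have eI : ker_of (Hlab Q :|: Relab Q) = ker_of (Relab S).
    by apply/eqP; rewrite eqEsubv sIQS.
  case: (capv_lker_between sHTQ sHQS) => eH; [left | right]; apply: eqW.
  - by rewrite /kerH eH HlabU1 ker_ofU1.
  - by rewrite eI -kT HlabU1 RelabU1l.
  - by rewrite /kerH eH.
  - by rewrite eI kS.
rewrite HlabU1r RelabU1 ker_ofU1 => sHTQ kT sITQ sIQS.
have eH : ker_of (Hlab Q) = ker_of (Hlab S) by apply/eqP; rewrite eqEsubv sHTQ andbT.
case: (capv_lker_between sITQ sIQS) => eI; [left | right]; apply: eqW.
- by rewrite /kerH eH HlabU1r.
- by rewrite eI HlabU1r RelabU1 kT.
- by rewrite /kerH eH.
- by rewrite eI kS.
Qed.

(** * Feasible sets are the nested independent pairs *)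

Lemma subspI0 : subspI finset.set0 = classical_sets.setT.
Proof. by apply/predeqP => z; split=> // _ e /=; rewrite inE. Qed.

Lemma cover_chain_nested_indep S s : nested_indep S -> cover_chain l (subspI S) s ->
  nested_indep ([set:: s] :|: S).
Proof.
elim: s S => [|e s IH] S gS /=; first by rewrite set_nil set0U.
case=> /(lattice_cover_addable _ gS) /(nested_indep_addable gS) gSe.
rewrite subspIU1 => /(IH _ gSe).
by rewrite set_cons -setUA setUCA.
Qed.

(** Chains are defined from the front, but the induction below removes the last element. *)
Lemma cover_chain_rcons S s e : cover_chain l (subspI S) (rcons s e) <->
  cover_chain l (subspI S) s /\
  lattice_cover l (subspI ([set:: s] :|: S)) (subspI ([set:: s] :|: S) `&` subsp l e)%classic.
Proof.
elim: s S => [|f s IH] S /=; first by rewrite set_nil set0U; tauto.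
by rewrite subspIU1 IH set_cons -setUA setUCA; tauto.
Qed.

Lemma mem_feasible X : (X \in feasible l) = nested_indep X.
Proof.
rewrite inE; apply/asboolP/idP => [[s [->]]|].
  rewrite -subspI0 => /(cover_chain_nested_indep nested_indep0).
  by rewrite setU0.
rewrite -subspI0; move: {2}#|X| (erefl #|X|) => k.
elim: k X => [|k IH] X cX gX.
  by exists [::]; split=> //; apply/eqP; rewrite set_nil -cards_eq0 cX.
(* The element removable by the first greedoid axiom serves as the last step of the chain. *)
have [|e [eX gXe aXe]] := nested_indep_IG1 gX; first by rewrite -cards_eq0 cX.
have [||s [eXs chs]] := IH (X :\ e) => //.
  by apply/eqP; rewrite -eqSS -cX (cardsD1 e X) eX.
exists (rcons s e); split.
  by apply/setP => f; rewrite -(setD1K eX) eXs !inE mem_rcons inE.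
apply/cover_chain_rcons; split=> //; rewrite -eXs setU0.
exact/lattice_cover_addable.
Qed.

End Feasible.

(** * Flats and supports in a general set system *)

Lemma flat_Gam_of (E : finType) (F : {set {set E}}) (X : {set E}) :
  X \in F -> flat_Gam F (flat_of F X) = Gam F X.
Proof.
move=> XF; apply/setP => e; apply/bigcupP/idP => [[Y] | eX].
  by rewrite inE => /andP[_ /eqP->].
by exists X; rewrite // inE XF eqxx.
Qed.

Lemma flat_joinE (E : finType) (F : {set {set E}}) A B (S T : {set E}) :
  flat_xi A = S -> flat_xi B = T -> flat_join F A B = flat_mu F (S :&: T).
Proof. by move=> <- <-. Qed.

(** The symbols [Plus] and [Minus] occur exactly on [flat_Gam], and this set determines the flat;
    hence the support is unique. *)
Lemma suppE (E : finType) (F : {set {set E}}) (al : E -> gsign) A :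
  is_supp F al A -> supp F al = A.
Proof.
suff Gam_pm B : is_supp F al B ->
    flat_Gam F B = [set e | match al e with Plus | Minus => true | _ => false end].
  move=> sA; apply: xget_unique => // B sB; have := Gam_pm _ sB.
  rewrite -(Gam_pm _ sA); case: sA => /imsetP[X XF ->] _; case: sB => /imsetP[Y YF ->] _.
  by rewrite !flat_Gam_of // /flat_of => ->.
case=> _ sB; apply/setP => e; rewrite inE; have [pm zero one] := sB e.
case: (boolP (e \in flat_Gam F B)) => [/pm[]-> // | nG].
case: (boolP (e \in flat_xi B)) => [/zero -> // | nx].
by rewrite one // inE negb_or nG.
Qed.

(** * Flats of the greedoid as nested pairs of matroid flats *)

Section Flats.
Variables (R : realType) (d n : nat) (l : 'I_n -> 'Hom('rV[R]_d, R^o)).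
Hypothesis l_neq0 : forall i, ~~ (fullv <= lker (l i))%VS.
Implicit Types (X Y Z S : {set gset n}) (U : {vspace 'rV[R]_d}).
Local Notation F := (feasible l).
Local Notation nested_indep := (nested_indep l).
Local Notation kerRe := (kerRe l).
Local Notation kerH := (kerH l).
Local Notation addable := (addable l).

Lemma Gam_addable X : nested_indep X -> Gam F X = [set e | addable X e].
Proof. by move=> gX; apply/setP => e; rewrite 2!in_set in_setC mem_feasible nested_indepU1. Qed.

Lemma feasible_interval_greedoid : interval_greedoid F.
Proof.
split.
- by apply/set0Pn; exists finset.set0; rewrite mem_feasible nested_indep0.
- move=> X; rewrite mem_feasible => gX /(nested_indep_IG1 gX)[e [eX gXe _]].
  by exists e; rewrite ?mem_feasible.
- move=> X Y; rewrite !mem_feasible => gX gY /(nested_indep_IG2 gX gY)[e eX].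
  by rewrite -nested_indepU1 // => /andP[eY geY]; exists e; rewrite ?mem_feasible // in_setD eY.
move=> X Y Z e; rewrite !mem_feasible => gX gY gZ sXY sYZ eZ geX geZ.
apply: nested_indep_addable => //; apply: (addable_mid sXY sYZ); rewrite -nested_indepU1 ?eZ //.
by rewrite geX andbT; apply: contra eZ => /(subsetP sXY)/(subsetP sYZ).
Qed.

(** Addable labels $H_i^\Re$ recover [kerRe]. Addable labels $H_i$ test [kerH] only for forms
    vanishing on [kerRe], but by nestedness these include all forms that define [kerH]. *)
Lemma eq_GamP X Y : nested_indep X -> nested_indep Y ->
  (Gam F X = Gam F Y) <-> kerRe X = kerRe Y /\ kerH X = kerH Y.
Proof.
move=> gX gY; rewrite !Gam_addable //; split=> [GXY|[eR eH]]; last first.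
  by apply/setP => -[] i; rewrite !inE /= ?eR ?eH.
have {GXY} aXY e : addable X e = addable Y e by move/setP/(_ e): GXY; rewrite !inE.
have eR i : (kerRe X <= lker (l i))%VS = (kerRe Y <= lker (l i))%VS.
  by apply: negb_inj; apply: (aXY (inr i)).
have RXY : kerRe X = kerRe Y.
  apply/eqP; rewrite eqEsubv; apply/andP; split; apply/ker_ofP => i iR.
    by rewrite eR ker_of_sub.
  by rewrite -eR ker_of_sub.
split=> //; have eH i : (kerRe X <= lker (l i))%VS ->
    (kerH X <= lker (l i))%VS = (kerH Y <= lker (l i))%VS.
  by move=> sR; have := aXY (inl i); rewrite /= -RXY sR => /negb_inj.
have sRH Z i : nested_indep Z -> i \in Hlab Z -> (kerRe Z <= lker (l i))%VS.
  by case/and3P=> _ _ /subv_trans sRH iZ; apply/sRH/ker_of_sub.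
apply/eqP; rewrite eqEsubv; apply/andP; split; apply/ker_ofP => i iH.
  by rewrite eH; [exact: ker_of_sub | rewrite RXY sRH].
by rewrite -eH; [exact: ker_of_sub | rewrite sRH].
Qed.

(** Matroid closure on each kind of label separately; for feasible [X] it is $\xi$ of the flat of
    [X]. *)
Definition cl X : {set gset n} :=
  [set e | match e with
           | inl i => (kerH X <= lker (l i))%VS
           | inr i => (kerRe X <= lker (l i))%VS
           end].

Definition is_flat S := cl S = S /\ forall i, inl i \in S -> inr i \in S.

Lemma kerH_cl X : kerH (cl X) = kerH X.
Proof.
apply/eqP; rewrite eqEsubv; apply/andP; split; apply/ker_ofP => i.
  by move=> iX; apply: ker_of_sub; rewrite !inE ker_of_sub.
by rewrite !inE.
Qed.

Lemma kerRe_cl X : kerRe (cl X) = kerRe X.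
Proof.
apply/eqP; rewrite eqEsubv; apply/andP; split; apply/ker_ofP => i.
  by move=> iX; apply: ker_of_sub; rewrite !inE ker_of_sub.
by rewrite !inE.
Qed.

Lemma is_flat_cl X : nested_indep X -> is_flat (cl X).
Proof.
case/and3P=> _ _ sRH; split=> [|i].
  by apply/setP => -[] i; rewrite !inE /= ?kerH_cl ?kerRe_cl.
by rewrite !inE; apply: subv_trans.
Qed.

Lemma maxset_ker S X : (forall i, inl i \in S -> inr i \in S) ->
  maxset [pred Y | (Y \in F) && (Y \subset S)] X ->
  [/\ nested_indep X, kerRe X = kerRe S & kerH X = kerH S].
Proof.
move=> lrS /maxsetP[/andP[]]; rewrite mem_feasible => gX sXS maxX.
(* By maximality no element of [S] is addable. As [S] contains $H_i^\Re$ along with $H_i$, the only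
   obstruction to adding $H_i$ is that $\ell_i$ vanishes on [kerH X]. *)
have nadd e : e \in S -> ~~ addable X e.
  move=> eS; apply/negP; rewrite -nested_indepU1 // => /andP[/negP eX geX].
  case: eX; rewrite -(maxX (e |: X)) ?setU11 ?subsetUr //=.
  by rewrite mem_feasible geX subUset sub1set eS sXS.
have sR i : inr i \in S -> (kerRe X <= lker (l i))%VS.
  by move/nadd; rewrite /= negbK.
split=> //; apply/eqP; rewrite eqEsubv.
  by rewrite (kerReS l sXS) andbT; apply/ker_ofP => i; rewrite inE => /sR.
rewrite (kerHS l sXS) andbT; apply/ker_ofP => i.
by rewrite inE => iS; have := nadd _ iS; rewrite /= sR ?lrS //= negbK.
Qed.

Lemma flat_mu_of S : (forall i, inl i \in S -> inr i \in S) ->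
  exists X, [/\ flat_mu F S = flat_of F X, nested_indep X, kerRe X = kerRe S
              & kerH X = kerH S].
Proof.
move=> lrS; rewrite /flat_mu; case: pickP => [X /(maxset_ker lrS)[] | noX].
  by exists X.
(* The default in [flat_mu] is never reached, since the empty set is a candidate. *)
have P0 : [pred Y | (Y \in F) && (Y \subset S)] finset.set0.
  by rewrite /= mem_feasible nested_indep0 sub0set.
by have [Y mY _] := maxset_exists P0; rewrite noX in mY.
Qed.

Lemma flat_xi_of X : nested_indep X -> flat_xi (flat_of F X) = cl X.
Proof.
move=> gX; apply/setP => e; apply/bigcupP/idP => [[Y] | eX].
  rewrite inE mem_feasible => /andP[gY /eqP/(eq_GamP gY gX)[eR eH]].
  by case: e => i iY; rewrite inE /= -?eR -?eH ker_of_sub ?inE.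
have [_ lrX] := is_flat_cl gX.
(* As $\ell_i\ne0$, each label lies in a feasible set $\{H_i^\Re\}$ or $\{H_i,H_i^\Re\}$ inside
   [cl X]; a maximal feasible extension within [cl X] is equivalent to [X]. *)
have [X0 [gX0 sX0 eX0]] : exists X0, [/\ nested_indep X0, X0 \subset cl X & e \in X0].
  have gRe i : nested_indep (inr i |: finset.set0).
    apply: nested_indep_addable (nested_indep0 l) _ => /=.
    rewrite /kerRe (_ : Relab finset.set0 = finset.set0) ?ker_of0 //.
    by apply/setP => j; rewrite !inE.
  case: e eX => i iX; last first.
    by exists (inr i |: finset.set0); rewrite setU11 gRe setU0 sub1set.
  exists (inl i |: (inr i |: finset.set0)); split.
  - apply: nested_indep_addable => //=; rewrite ker_of_sub ?inE ?eqxx //=.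
    rewrite /kerH HlabU1r (_ : Hlab finset.set0 = finset.set0) ?ker_of0 //.
    by apply/setP => j; rewrite !inE.
  - by rewrite !subUset !sub1set iX lrX //= sub0set.
  by rewrite setU11.
have P0 : [pred Y | (Y \in F) && (Y \subset cl X)] X0 by rewrite /= mem_feasible gX0.
have [Y mY sXY] := maxset_exists P0.
have [gY eR eH] := maxset_ker lrX mY.
exists Y; last exact: (subsetP sXY).
rewrite inE mem_feasible gY; apply/eqP/eq_GamP => //.
by rewrite eR eH kerRe_cl kerH_cl.
Qed.

Lemma flat_mu_flat S : is_flat S ->
  [/\ flat_mu F S \in flats F, flat_xi (flat_mu F S) = S
    & flat_Gam F (flat_mu F S) =
        [set e | match e with
                 | inl i => (inr i \in S) && (inl i \notin S)
                 | inr i => inr i \notin S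
                 end]].
Proof.
case=> clS /flat_mu_of[X [-> gX eR eH]].
have clX : cl X = S by rewrite -[RHS]clS; apply/setP => -[] i; rewrite !inE ?eR ?eH.
split; first by apply: imset_f; rewrite mem_feasible.
  by rewrite flat_xi_of.
rewrite flat_Gam_of ?mem_feasible // Gam_addable // -clX.
by apply/setP => -[] i; rewrite !inE.
Qed.

Lemma flat_of_mu X : nested_indep X -> flat_of F X = flat_mu F (cl X).
Proof.
move=> gX; have [_ /flat_mu_of[Y [-> gY eR eH]]] := is_flat_cl gX.
by rewrite /flat_of (_ : Gam F Y = Gam F X) //; apply/eq_GamP; rewrite // eR eH kerRe_cl kerH_cl.
Qed.

End Flats.

(** * Signs of real numbers under perturbation and positive combination *)

Section RealSign.
Variable R : realFieldType.
Implicit Types a b s t : R.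

Definition rsign a : gsign := if 0 < a then Plus else if a < 0 then Minus else Zero.

Variant rsign_spec a : gsign -> bool -> Type :=
  | RsignPos of 0 < a : rsign_spec a Plus false
  | RsignNeg of a < 0 : rsign_spec a Minus false
  | RsignZero of a = 0 : rsign_spec a Zero true.

Lemma rsignP a : rsign_spec a (rsign a) (a == 0).
Proof. by rewrite /rsign; case: ltrgt0P => [a0|a0|->]; constructor. Qed.

Lemma rsign0 a : a = 0 -> rsign a = Zero.
Proof. by move=> ->; rewrite /rsign ltxx. Qed.

Lemma rsign_eq0 a : (a == 0) = if rsign a is Zero then true else false.
Proof. by case: rsignP. Qed.

Lemma rsign_pos a : 0 < a -> rsign a = Plus.
Proof. by rewrite /rsign => ->. Qed.

Lemma rsign_neg a : a < 0 -> rsign a = Minus.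
Proof. by rewrite /rsign => a0; rewrite a0 ltNge ltW. Qed.

Lemma rsignN a : rsign (- a) = gsign_opp (rsign a).
Proof.
case: (rsignP a) => [a0|a0|->]; rewrite ?oppr0 /rsign ?ltxx //.
  by rewrite oppr_gt0 oppr_lt0 a0 ltNge ltW.
by rewrite oppr_gt0 a0.
Qed.

(** Nonzero real signs are incomparable, so composition overwrites only zeros. *)
Lemma rsign_lt_comp a b :
  (if gsign_lt (rsign a) (rsign b) then rsign b else rsign a)
  = (if a == 0 then rsign b else rsign a).
Proof. by case: (rsignP a); case: (rsignP b). Qed.

Lemma rsign_perturb (I : finType) (a b : I -> R) :
  exists2 e, 0 < e & forall i,
    rsign (a i + e * b i) = if a i == 0 then rsign (b i) else rsign (a i).
Proof.
(* This bounds every ratio $|b_i|/|a_i|$ strictly, so $|b_i|/m<|a_i|$ when $a_i\ne0$. Terms with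
   $a_i=0$ count as zero, and the summand 1 keeps $m$ positive. *)
pose m : R := 1 + \sum_i `|b i| / `|a i|.
have m0 : 0 < m by rewrite ltr_pwDl // sumr_ge0 // => i _; rewrite divr_ge0.
exists m^-1; rewrite ?invr_gt0 // => i.
have Bm : `|b i| / `|a i| < m.
  rewrite /m (bigD1 i) //= addrCA ltrDl ltr_pwDl // sumr_ge0 // => j _.
  by rewrite divr_ge0.
have e0 : 0 < m^-1 by rewrite invr_gt0.
case: (eqVneq (a i) 0) => [-> | ai0].
  rewrite add0r; case: (rsignP (b i)) => [bi|bi|->].
  - by rewrite rsign_pos // mulr_gt0.
  - by rewrite rsign_neg // pmulr_rlt0.
  - by rewrite mulr0 rsign0.
have : `|m^-1 * b i| < `|a i|.
  rewrite normrM gtr0_norm // mulrC ltr_pdivrMr // mulrC.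
  by rewrite -ltr_pdivrMr ?normr_gt0.
rewrite ltr_norml; case: (rsignP (a i)) ai0 => [ai|ai|->]; rewrite ?eqxx // => _.
- by rewrite (gtr0_norm ai) => /andP[H _]; rewrite rsign_pos //; lra.
by rewrite (ltr0_norm ai) => /andP[_ H]; rewrite rsign_neg //; lra.
Qed.

Lemma rsign_conv s t a b : 0 < s -> 0 < t ->
  ~ (rsign a = gsign_opp (rsign b) /\ (rsign a = Plus \/ rsign a = Minus)) ->
  rsign (s * a + t * b) = (if a == 0 then rsign b else rsign a) /\
  (if a == 0 then rsign b else rsign a) = (if b == 0 then rsign a else rsign b).
Proof.
move=> s0 t0; case: (rsignP a) => [a0|a0|->]; case: (rsignP b) => [b0|b0|->] //= H;
  try (by case: H; split; [|by [left|right]]); split=> //; rewrite ?mulr0 ?add0r ?addr0.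
all: try by rewrite rsign_pos ?addr_gt0 ?mulr_gt0.
all: try by rewrite rsign_neg // ?pmulr_rlt0 // addrC ltr_wnDl ?ltW ?pmulr_rlt0.
by rewrite rsign0.
Qed.

Lemma rsign_cancel a b :
  rsign a = gsign_opp (rsign b) -> rsign a = Plus \/ rsign a = Minus ->
  [/\ 0 < `|b|, 0 < `|a| & rsign (`|b| * a + `|a| * b) = Zero].
Proof.
case: (rsignP a) => [a0|a0|->]; case: (rsignP b) => [b0|b0|->] //= _; try by case.
  by rewrite (gtr0_norm a0) (ltr0_norm b0) oppr_gt0; split=> //; apply: rsign0; ring.
by rewrite (ltr0_norm a0) (gtr0_norm b0) oppr_gt0; split=> //; apply: rsign0; ring.
Qed.

End RealSign.

(** * The covectors and the axioms of an oriented interval greedoid *)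

Section Covectors.
Variables (R : realType) (d n : nat) (l : 'I_n -> 'Hom('rV[R]_d, R^o)).
Hypothesis l_neq0 : forall i, ~~ (fullv <= lker (l i))%VS.
Implicit Types (x y : 'rV[R]_d) (e : gset n).
Local Notation F := (feasible l).

Definition sign_at x y e : gsign :=
  match e with
  | inl i => if l i y == 0 then rsign (l i x) else One
  | inr i => rsign (l i y)
  end.

Lemma alpha_sign_at z : alpha l z = sign_at (repart z) (impart z).
Proof. by apply/funext => -[] i //; rewrite /alpha /sigma_Re /= if_neg. Qed.

Lemma covectorsP al : covectors l al <-> exists x y, al = sign_at x y.
Proof.
split=> [[z _ <-] | [x [y ->]]]; first by exists (repart z), (impart z); rewrite alpha_sign_at.
by exists (cvec x y); rewrite // alpha_sign_at cvec_repart cvec_impart.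
Qed.

(** The members of $E_{\mathcal A}$ containing $x+iy$, which form $\xi$ of the support. *)
Definition zset x y : {set gset n} :=
  [set e | match e with
           | inl i => (l i y == 0) && (l i x == 0)
           | inr i => l i y == 0
           end].

Lemma zset_flat x y : is_flat l (zset x y).
Proof.
split=> [|i]; last by rewrite !inE => /andP[].
apply/setP => -[] i; rewrite !inE; apply/idP/idP.
- move=> /subvP sHi; rewrite -!memv_ker.
  by apply/andP; split; apply: sHi; apply/mem_ker_ofP => j; rewrite !inE => /andP[/eqP ? /eqP].
- by move=> iz; apply: ker_of_sub; rewrite !inE.
- move=> /subvP sRi; rewrite -memv_ker; apply: sRi.
  by apply/mem_ker_ofP => j; rewrite !inE => /eqP.
by move=> iz; apply: ker_of_sub; rewrite !inE.
Qed.

Lemma sign_at_supp x y : is_supp F (sign_at x y) (flat_mu F (zset x y)).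
Proof.
have [muF xi Gm] := flat_mu_flat l_neq0 (zset_flat x y).
split=> // e; rewrite xi Gm !inE; case: e => i; rewrite !inE /=.
  case: (rsignP (l i x)); case: (l i y == 0) => //=; split=> //; by [left | right].
by case: (rsignP (l i y)) => /=; split=> //; by [left | right].
Qed.

Lemma perturb_pair x y x' y' : exists x2 y2,
  (forall i, rsign (l i x2) = if l i x == 0 then rsign (l i x') else rsign (l i x)) /\
  (forall i, rsign (l i y2) = if l i y == 0 then rsign (l i y') else rsign (l i y)).
Proof.
pose a (e : 'I_n + 'I_n) := match e with inl i => l i x | inr i => l i y end : R.
pose b (e : 'I_n + 'I_n) := match e with inl i => l i x' | inr i => l i y' end : R.
(* Treating all $2n$ values as one family gives the same $t$ for both parts. *)
have [t t0 E] := rsign_perturb a b.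
exists (x + t *: x'), (y + t *: y').
by split=> i; [have := E (inl i) | have := E (inr i)]; rewrite /= !linearD !linearZ.
Qed.

Lemma zset_perturb x y x' y' x2 y2 :
  (forall i, rsign (l i x2) = if l i x == 0 then rsign (l i x') else rsign (l i x)) ->
  (forall i, rsign (l i y2) = if l i y == 0 then rsign (l i y') else rsign (l i y)) ->
  zset x2 y2 = zset x y :&: zset x' y'.
Proof.
move=> Ex Ey; apply/setP => -[] i; rewrite !inE !(rsign_eq0 (l i _)) ?Ex Ey.
  rewrite !(rsign_eq0 (l i _)).
  by case: (rsign (l i x)); case: (rsign (l i x')); case: (rsign (l i y));
    case: (rsign (l i y')).
by rewrite !(rsign_eq0 (l i _)); case: (rsign (l i y)); case: (rsign (l i y')).
Qed.

Lemma flat_join_zset x y x' y' :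
  flat_join F (flat_mu F (zset x y)) (flat_mu F (zset x' y'))
  = flat_mu F (zset x y :&: zset x' y').
Proof.
have [_ xi _] := flat_mu_flat l_neq0 (zset_flat x y).
have [_ xi' _] := flat_mu_flat l_neq0 (zset_flat x' y').
exact: flat_joinE.
Qed.

Lemma cov_comp_sign_at x y x' y' e :
  cov_comp F (sign_at x y) (sign_at x' y') e =
  match e with
  | inl i => if (l i y == 0) && (l i y' == 0) then
               if l i x == 0 then rsign (l i x') else rsign (l i x)
             else One
  | inr i => if l i y == 0 then rsign (l i y') else rsign (l i y)
  end.
Proof.
rewrite /cov_comp !(suppE (sign_at_supp _ _)) flat_join_zset.
have [x2 [y2 [Ex Ey]]] := perturb_pair x y x' y'.
(* The intersection of the two zero sets is the zero set of a perturbed vector, hence again a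
   flat. *)
have := zset_flat x2 y2; rewrite (zset_perturb Ex Ey) => /(flat_mu_flat l_neq0)[_ -> ->].
rewrite !inE; case: e => i; rewrite !inE /=.
  rewrite -rsign_lt_comp.
  by case: (l i y == 0); case: (l i y' == 0); rewrite /= ?andbF ?orNb.
by rewrite orNb rsign_lt_comp.
Qed.

(** The hyperplanes not containing [U] are avoided one at a time, by perturbations small enough to
    keep earlier nonzero values nonzero. *)
Lemma generic_vector (U : {vspace 'rV[R]_d}) :
  exists2 v, v \in U & forall i, (l i v == 0) = (U <= lker (l i))%VS.
Proof.
suff [v vU nz] : exists2 v, v \in U & forall i, i \in enum 'I_n ->
    ~~ (U <= lker (l i))%VS -> l i v != 0.
  exists v => // i; apply/idP/idP => [|/subvP/(_ v vU)]; last by rewrite memv_ker.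
  by apply: contraTT => nUi; apply: nz; rewrite ?mem_enum.
elim: (enum _) => [|i s [v vU IH]]; first by exists 0; rewrite ?mem0v.
case: (boolP (U <= lker (l i))%VS) => [sUi | /subvPn[u uU]].
  by exists v => // j /predU1P[->|/IH//]; rewrite sUi.
rewrite memv_ker => ui0.
have [t t0 E] := rsign_perturb (fun j => l j v : R) (fun j => l j u : R).
exists (v + t *: u); first by rewrite rpredD ?rpredZ.
move=> j; rewrite inE linearD linearZ /= (rsign_eq0 (_ + _)) E => /predU1P[-> _ | js nj].
  by case: (eqVneq (l i v) 0) => [_|]; rewrite -rsign_eq0.
by rewrite (negbTE (IH _ js nj)) -rsign_eq0 IH.
Qed.

Lemma covectors_OG1 : OG1 F (covectors l).
Proof.
move=> A /imsetP[X]; rewrite mem_feasible => gX ->.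
(* Generic real and imaginary parts in [kerH l X] and [kerRe l X] vanish only where forced, so the
   zero set is [cl l X]. *)
have [x xX Ex] := generic_vector (kerH l X).
have [y yX Ey] := generic_vector (kerRe l X).
exists (sign_at x y); first by apply/covectorsP; exists x, y.
rewrite (suppE (sign_at_supp x y)) (flat_of_mu gX); congr (flat_mu F _).
apply/setP => -[] i; rewrite !inE ?Ex Ey //.
case: (boolP (kerH l X <= _)%VS); rewrite ?andbF // andbT.
by apply: subv_trans; case/and3P: gX.
Qed.

Lemma cov_opp_sign_at x y : cov_opp (sign_at x y) = sign_at (- x) (- y).
Proof.
apply/funext => -[] i; rewrite /cov_opp /= !linearN rsignN //= oppr_eq0.
by case: ifP.
Qed.

Lemma covectors_OG2 : OG2 (covectors l).
Proof.
apply/predeqP => al; split=> [[be /covectorsP[x [y ->]] <-] | /covectorsP[x [y ->]]].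
  by apply/covectorsP; exists (- x), (- y); rewrite cov_opp_sign_at.
exists (sign_at (- x) (- y)); last by rewrite cov_opp_sign_at !opprK.
by apply/covectorsP; exists (- x), (- y).
Qed.

Lemma covectors_OG3 : OG3 F (covectors l).
Proof.
move=> _ _ /covectorsP[x [y ->]] /covectorsP[x' [y' ->]]; apply/covectorsP.
have [x2 [y2 [Ex Ey]]] := perturb_pair x y x' y'.
exists x2, y2; apply/funext => e; rewrite cov_comp_sign_at.
case: e => i /=; rewrite ?Ex ?Ey // (rsign_eq0 (l i y2)) Ey !(rsign_eq0 (l i y)).
by rewrite (rsign_eq0 (l i y')); case: (rsign (l i y)); case: (rsign (l i y')).
Qed.

Lemma covectors_OG4 : OG4 F (covectors l).
Proof.
move=> _ _ e /covectorsP[x [y ->]] /covectorsP[x' [y' ->]] [opp pm].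
rewrite cov_comp_sign_at => none.
(* The weights are the absolute values of the opposite coordinates, which cancel. For $H_i$, the
   product not being [One] makes both imaginary values zero, so the combination has symbol [Zero]
   and not [One]. *)
have [s [t [s0 t0 e0]]] : exists s t : R, [/\ 0 < s, 0 < t &
    sign_at (s *: x + t *: x') (s *: y + t *: y') e = Zero].
  case: e opp pm none => i /=.
    case: eqP => //= y0; case: eqP => //= y'0 opp pm _.
    have [b0 a0 E] := rsign_cancel opp pm.
    exists `|l i x' : R|, `|l i x : R|; split=> //.
    rewrite !linearD !linearZ /= y0 y'0 !scaler0 addr0 eqxx.
    exact: E.
  move=> opp pm _; have [b0 a0 E] := rsign_cancel opp pm.
  exists `|l i y' : R|, `|l i y : R|; split=> //.
  by rewrite !linearD !linearZ; apply: E.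
exists (sign_at (s *: x + t *: x') (s *: y + t *: y')); split=> //.
  by apply/covectorsP; exists (s *: x + t *: x'), (s *: y + t *: y').
move=> f; rewrite !cov_comp_sign_at /sep; case: f => i /=; last first.
  move=> nsep _; have [E1 E2] := rsign_conv s0 t0 nsep.
  by rewrite linearD !linearZ /= E1.
case: eqP => [y0|] //=; case: eqP => [y'0|] //= nsep _.
have [E1 E2] := rsign_conv s0 t0 nsep.
by rewrite !linearD !linearZ /= y0 y'0 !scaler0 addr0 eqxx E1.
Qed.

Lemma covectors_oriented : oriented_interval_greedoid F (covectors l).
Proof.
split; first exact: feasible_interval_greedoid.
  move=> _ /covectorsP[x [y ->]]; exists (flat_mu F (zset x y)).
  exact: sign_at_supp.
by split; [exact: covectors_OG1 | exact: covectors_OG2 | exact: covectors_OG3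
          | exact: covectors_OG4].
Qed.

End Covectors.

(** * Passage from hyperplanes to nonzero forms *)

Theorem mainTheorem8 (R : realType) (d n : nat)
    (Theta : 'I_n -> {vspace 'rV[R]_d}) (l : 'I_n -> 'Hom('rV[R]_d, R^o%R))
    (hyperplane_Theta : forall i : 'I_n, (\dim (Theta i)).+1 = d)
    (essential_Theta : (\bigcap_(i < n) Theta i)%VS = 0%VS)
    (Theta_ker : forall i : 'I_n, Theta i = lker (l i)) :
  oriented_interval_greedoid (feasible l) (covectors l).
Proof.
(* A form vanishing everywhere would have a kernel of dimension $d$, not $d-1$. *)
apply: covectors_oriented => i; apply/negP => /dimvS.
rewrite dimvf dim_matrix mul1r -Theta_ker.
by rewrite -ltnS (hyperplane_Theta i) ltnn.
Qed.
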